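(* Let $p$ be an odd prime number. Then there exists a finite transitive imprimitive permutation group $G$ such that $b(G)=2$ and the Saxl graph $\Sigma(G)$ has exactly $p$ connected components.
   Context: A base for a permutation group $G\leqslant \mathrm{Sym}(\Omega)$ is a subset of $\Omega$ whose pointwise stabiliser in $G$ is trivial; $b(G)$ is the minimal cardinality of a base. The Saxl graph $\Sigma(G)$ has vertex set $\Omega$, with two (distinct) vertices adjacent if and only if they form a base for $G$. *)

(* Defs.v *)
From mathcomp Require Import all_boot all_fingroup all_solvable.

Set Implicit Arguments.
Unset Strict Implicit.
Unset Printing Implicit Defensive.

Local Open Scope group_scope.

Definition is_base (T : finType) (G : {group {perm T}}) (B : {set T}) : bool :=
  'C_G(B | 'P) == 1.

(* The default [set: T] of the arg min is always a base (is_base_setT), so this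
   is the least cardinality of a base (base_sizeP). *)
Definition base_size (T : finType) (G : {group {perm T}}) : nat :=
  #|[arg min_(B < [set: T] | is_base G B) #|B| ]|.

Definition saxl_graph (T : finType) (G : {group {perm T}}) : rel T :=
  fun x y => (x != y) && is_base G [set x; y].

Definition imprimitive (T : finType) (G : {group {perm T}}) : bool :=
  [exists Q : {set {set T}}, imprimitivity_system G [set: T] 'P Q].

Lemma is_base_setT (T : finType) (G : {group {perm T}}) : is_base G [set: T].
Proof.
rewrite /is_base; apply/eqP/trivgP/subsetP=> s /setIP[_ /astabP fix_s].
by rewrite inE; apply/eqP/permP=> x; rewrite perm1 -[RHS](fix_s x) ?inE.
Qed.

Lemma base_sizeP (T : finType) (G : {group {perm T}}) :
  (exists2 B, is_base G B & #|B| = base_size G)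
  /\ (forall B, is_base G B -> base_size G <= #|B|).
Proof.
rewrite /base_size; case: arg_minnP => [|B bB minB]; first exact: is_base_setT.
by split=> //; exists B.
Qed.

(* fingraph's n_comp counts connected components only under this condition. *)
Lemma saxl_connect_sym (T : finType) (G : {group {perm T}}) :
  connect_sym (saxl_graph G).
Proof. by apply: sym_connect_sym => x y; rewrite /saxl_graph eq_sym setUC. Qed.

(* Main.v *)
(** Let C_2 wr Z_2p act on the set of pairs (i, u), where i is in Z_2p and u is
    a 0/1-labelling of the half circle {i, ..., i + p - 1}: rotations move the
    half circle, and a labelling v of the whole circle is added to u. The
    stabiliser of (i, u) and (j, w) consists of the v vanishing on both half
    circles, so it is trivial iff these cover Z_2p, i.e. iff j = i + p. Hence
    the Saxl graph is a disjoint union of p complete bipartite graphs, one for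
    each antipodal pair {i, i + p}. *)

Require Import Defs.
From mathcomp Require Import all_boot all_fingroup all_solvable.
From mathcomp Require Import ssralg zmodp zify.

Set Implicit Arguments.
Unset Strict Implicit.
Unset Printing Implicit Defensive.

Import GRing.Theory.

(** Each component contains exactly one root, and [f] maps the roots bijectively onto [U]. *)
Lemma n_comp_fibers (T U : finType) (e : rel T) (f : T -> U) :
    connect_sym e -> (forall x y, connect e x y = (f x == f y)) ->
    (forall u, exists x, f x = u) ->
  n_comp e T = #|U|.
Proof.
move=> sym_e conn_f surj_f; rewrite /n_comp_mem.
have inj_f : {in [predI roots e & T] &, injective f}.
  move=> x y /andP[/eqP rx _] /andP[/eqP ry _] /eqP.
  by rewrite -conn_f => /(rootP sym_e); rewrite rx ry.
rewrite -(card_in_imset inj_f) -cardsT; apply: eq_card => u; rewrite inE.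
have [x <-] := surj_f u; apply/imsetP; exists (root e x).
  by rewrite !inE roots_root.
by apply/eqP; rewrite -conn_f connect_root.
Qed.

(** * The wreath product and its action *)

Section HalfCircles.

Variable q : nat.

(** Writing p as a successor makes [circle], of order 2p = 2q + 2, visibly nonempty, so that it
    carries the additive group Z_2p. *)
Notation p := q.+1.
Notation circle := 'I_q.*2.+2.

Definition omega : finType := (circle * {ffun 'I_p -> bool})%type.

Local Open Scope ring_scope.

Definition half : circle := inZp p.

(* The k-th bit of x.2 is the label of the point x.1 + k of the circle. *)
Definition twist (r : circle) (v : {ffun circle -> bool}) (x : omega) : omega :=
  (x.1 + r, [ffun k : 'I_p => x.2 k (+) v (x.1 + inZp k)]).

(** This is the wreath product multiplication: [w] is read after the base point has moved by [r],
    hence the shift [z + r]. *)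
Lemma twist_comp r v s w x :
  twist s w (twist r v x) =
  twist (r + s) [ffun z => v z (+) w (z + r)] x.
Proof.
congr pair; first by rewrite /= addrA.
by apply/ffunP=> k; rewrite !ffunE /= addbA addrAC.
Qed.

Lemma twist0 (v : {ffun circle -> bool}) : v =1 xpred0 -> twist 0 v =1 id.
Proof.
move=> v0 [i u]; congr pair; first by rewrite /= addr0.
by apply/ffunP=> k; rewrite ffunE v0 addbF.
Qed.

Lemma twist_inj r v : injective (twist r v).
Proof.
have twistK : cancel (twist r v) (twist (- r) [ffun z : circle => v (z - r)]); last first.
  exact: can_inj twistK.
move=> x; rewrite twist_comp subrr; apply: twist0 => z.
by rewrite !ffunE addrK addbb.
Qed.

Definition twist_perm (a : circle * {ffun circle -> bool}) : {perm omega} :=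
  perm (@twist_inj a.1 a.2).

Definition twists : {set {perm omega}} := [set twist_perm a | a in setT].

Lemma twists_group_set : group_set twists.
Proof.
apply/group_setP; split.
  apply/imsetP; exists (0, [ffun=> false]) => //.
  by apply/permP=> x; rewrite perm1 permE twist0 // => z; rewrite ffunE.
move=> _ _ /imsetP[[r v] _ ->] /imsetP[[s w] _ ->]; apply/imsetP.
exists (r + s, [ffun z => v z (+) w (z + r)]) => //.
by apply/permP=> x; rewrite permM !permE twist_comp.
Qed.

Definition twist_group : {group {perm omega}} := Group twists_group_set.

Lemma twist_groupP (g : {perm omega}) :
  reflect (exists r v, g =1 twist r v) (g \in twist_group).
Proof.
apply: (iffP imsetP) => [[[r v] _ ->]|[r [v def_g]]].
  by exists r, v => x; rewrite permE.
by exists (r, v) => //; apply/permP=> x; rewrite def_g permE.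
Qed.

Lemma twist_group_trans : [transitive twist_group, on [set: omega] | 'P].
Proof.
apply/imsetP; exists (0, [ffun=> false]) => //.
apply/setP=> -[i u]; rewrite inE; apply/esym/imsetP.
(* Starting from base point 0, only the values of [v] at 0, ..., p - 1 matter; beyond them [inord]
   takes its default. *)
pose v : {ffun circle -> bool} := [ffun z : circle => u (inord z)].
exists (twist_perm (i, v)); first by apply: imset_f.
rewrite /= /aperm permE /twist /= add0r; congr pair.
apply/ffunP=> k; rewrite !ffunE add0r /=.
by rewrite modn_small ?inord_val //; have := ltn_ord k; lia.
Qed.

(** * Half circles as arcs of Z_2p *)

Lemma inZp_half_add k : inZp (p + k) = half + inZp k.
Proof. by apply/val_inj; rewrite /= modnDm. Qed.

Lemma arc_cover (i z : circle) :
  exists k : 'I_p, z = i + inZp k \/ z = i + half + inZp k.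
Proof.
have [d ->] : exists d, z = i + d by exists (z - i); rewrite addrC subrK.
have [lt_p|ge_p] := ltnP d p.
  by exists (Ordinal lt_p); left; rewrite /= valZpK.
have lt_d : (d - p < p)%N by have := ltn_ord d; lia.
exists (Ordinal lt_d); right; rewrite -addrA -inZp_half_add /= subnKC //.
by rewrite valZpK.
Qed.

(** If [d + k] wraps around, it does so once and lands strictly below [c]; otherwise it already
    differs from [c] as a number. *)
Lemma inZp_add_neq (d : circle) (k c : nat) :
    (d + k < q.*2.+2 + c)%N -> (c < q.*2.+2)%N -> (d + k != c)%N ->
    (k < q.*2.+2)%N ->
  d + inZp k != inZp c.
Proof.
move=> lt_dk lt_c ne_c lt_k; apply/eqP=> /(congr1 val) /=.
rewrite (modn_small lt_k) (modn_small lt_c).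
have [lt_m|ge_m] := ltnP (d + k) q.*2.+2; first by rewrite modn_small //; lia.
by rewrite -(subnK ge_m) modnDr modn_small; lia.
Qed.

(** Measured from [i], the arcs occupy the offsets 0, ..., p - 1 and d, ..., d + p - 1 modulo 2p,
    with d different from p. Offset 2p - 1 is free if d < p, and offset p is free if d > p. *)
Lemma arc_miss (i j : circle) : j != i + half ->
  exists z : circle, forall k : 'I_p, (i + inZp k != z) && (j + inZp k != z).
Proof.
move=> ne_j; pose d := j - i; have def_j : j = i + d by rewrite addrC subrK.
have{ne_j} ne_d : d != p :> nat.
  apply: contraNneq ne_j => dp; rewrite def_j; apply/eqP; congr (_ + _).
  by rewrite /half -dp valZpK.
have lt_d := ltn_ord d; move: d => d in def_j ne_d lt_d *.
have ne_arc c : (forall k : 'I_p, k != c :> nat) -> (c < q.*2.+2)%N ->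
    (forall k : 'I_p, (d + k < q.*2.+2 + c)%N && (d + k != c)%N) ->
    exists z : circle, forall k : 'I_p, (i + inZp k != z) && (j + inZp k != z).
  move=> ne_c lt_c ne_dc; exists (i + inZp c) => k; have lt_k := ltn_ord k.
  rewrite def_j -addrA !(inj_eq (addrI i)); apply/andP; split.
    by rewrite -[inZp k]add0r; apply: inZp_add_neq; rewrite ?add0n ?ne_c //=; lia.
  by have /andP[? ?] := ne_dc k; apply: inZp_add_neq => //; lia.
have [lt_dp|ge_dp] := ltnP d p.
  by apply: (ne_arc q.*2.+1) => [k||k] //; have := ltn_ord k; lia.
by apply: (ne_arc p) => [k||k]; try have := ltn_ord k; lia.
Qed.

(** * Stabilisers, bases and base size *)

Lemma twist_fixes r (v : {ffun circle -> bool}) x :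
  twist r v x = x <-> r = 0 /\ forall k : 'I_p, v (x.1 + inZp k) = false.
Proof.
case: x => i u; split=> [[ri /ffunP vu] | [-> v0]].
  split=> [|k]; first by apply: (addrI i); rewrite ri addr0.
  by have := vu k; rewrite ffunE /=; case: (u k); case: (v _).
congr pair; first by rewrite /= addr0.
by apply/ffunP=> k; rewrite ffunE v0 addbF.
Qed.

Lemma is_base_pair x y :
  is_base twist_group [set x; y] = (y.1 == x.1 + half).
Proof.
apply/idP/idP=> [/eqP base_xy | /eqP def_y].
  apply/idPn=> /arc_miss[z miss_z].
  (* Flipping only the label at the missed point [z] fixes [x] and [y], but it moves any point whose
     half circle starts at [z]. *)
  pose g := twist_perm (0, [ffun t => t == z]).
  have: g \in 'C_twist_group([set x; y] | 'P)%g.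
    rewrite inE imset_f //=; apply/astabP=> t; rewrite !inE /= /aperm permE.
    by case/pred2P=> ->; apply/twist_fixes; split=> // k;
      rewrite ffunE; have /andP[/negPf ? /negPf ?] := miss_z k.
  rewrite base_xy => /set1P /permP/(_ (z, [ffun=> false])).
  rewrite perm1 permE => /twist_fixes[_ /(_ ord0)].
  by rewrite ffunE (_ : inZp _ = 0) ?addr0 ?eqxx //; apply/val_inj.
(* Conversely, [v] vanishes on both arcs, which cover the circle. *)
apply/eqP/trivgP/subsetP=> g /setIP[/twist_groupP[r [v def_g]] /astabP fix_g].
have /twist_fixes[r0 vx] : twist r v x = x.
  by rewrite -def_g -[RHS](fix_g x) ?inE ?eqxx.
have /twist_fixes[_ vy] : twist r v y = y.
  by rewrite -def_g -[RHS](fix_g y) ?inE ?eqxx ?orbT.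
rewrite inE; apply/eqP/permP=> t; rewrite perm1 def_g r0 twist0 // => z.
by have [k [-> | ->]] := arc_cover x.1 z; rewrite ?vx // -def_y vy.
Qed.

Lemma add_half_neq (i : circle) : i != i + half.
Proof.
rewrite -subr_eq0 opprD addNKr oppr_eq0; apply/eqP=> /(congr1 val) /=.
by rewrite modn_small //; lia.
Qed.

Lemma add_halfK (i : circle) : i + half + half = i.
Proof.
rewrite -addrA (_ : half + half = 0) ?addr0 //; apply/val_inj.
by rewrite /= modnDm addnn doubleS modnn.
Qed.

Lemma base_size_twist_group : base_size twist_group = 2.
Proof.
have [[B baseB <-] minB] := base_sizeP twist_group.
pose x0 : omega := (0, [ffun=> false]); pose y0 : omega := (half, [ffun=> false]).
apply/eqP; rewrite eqn_leq; apply/andP; split.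
  have := minB [set x0; y0]; rewrite is_base_pair add0r eqxx => /(_ isT).
  by move=> /leq_trans; apply; rewrite cards2; case: (_ != _).
rewrite leqNgt; apply/negP=> ltB.
(* A base with at most one point would make the degenerate pair [[set x; x]] a base, forcing
   [x.1 = x.1 + half]. *)
have [x sBx] : exists x, B \subset [set x; x].
  have [-> | [x Bx]] := set_0Vmem B; first by exists x0; rewrite sub0set.
  exists x; have /card_le1P/(_ x Bx) defB : (#|B| <= 1)%N by [].
  by apply/subsetP=> y; rewrite defB !inE => ->.
suff: is_base twist_group [set x; x] by rewrite is_base_pair (negPf (add_half_neq _)).
by rewrite /is_base -subG1 -(eqP baseB) setIS ?astabS.
Qed.

(** * Components of the Saxl graph *)

Lemma saxl_twist_group x y :
  saxl_graph twist_group x y = (y.1 == x.1 + half).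
Proof.
rewrite /saxl_graph is_base_pair andb_idl //.
by apply: contraTneq => ->; apply: add_half_neq.
Qed.

(** Reduction from Z_2p to Z_p has kernel {0, [half]}, so its fibres are the antipodal pairs. *)
Definition antipodal_class (x : omega) : 'I_p := inZp x.1.

Lemma antipodal_classP (x y : omega) :
  reflect (y.1 = x.1 \/ y.1 = x.1 + half)
          (antipodal_class x == antipodal_class y).
Proof.
have class_half (i : circle) : (inZp (i + half)%R : 'I_p) = inZp i.
  by apply/val_inj; rewrite /= modnDmr modn_dvdm ?modnDr // -doubleS -mul2n dvdn_mull.
case: x y => [i u] [j w] /=.
apply: (iffP eqP) => [/(congr1 val) /= eq_ij | eq_y].
  have lt_i := ltn_ord i; have lt_j := ltn_ord j.
  have modp k : (k < q.*2.+2 -> k %% p = if k < p then k else k - p)%N.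
    move=> lt_k; case: ltnP => [/modn_small // | ge_k].
    by rewrite -{1}(subnK ge_k) modnDr modn_small //; lia.
  have [eq_ji | ne_ji] := eqVneq (j : nat) i; [left | right].
    exact/val_inj.
  apply/val_inj => /=; rewrite (@modn_small p) ?ltnS; last lia.
  (* Distinct numbers below 2p that agree modulo p differ by exactly p; in the second case adding
     [half] to [i] wraps around. *)
  have [def_j | def_i] : (j = i + p :> nat \/ i = j + p :> nat)%N.
  - by move: eq_ij; rewrite !modp //; case: (ltnP i p); case: (ltnP j p); lia.
  - by rewrite -def_j modn_small.
  rewrite def_i -addnA (_ : (p + p)%N = q.*2.+2); last lia.
  by rewrite modnDr modn_small.
by rewrite /antipodal_class; case: eq_y => ->; rewrite ?class_half.
Qed.

Lemma connect_saxl x y :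
  connect (saxl_graph twist_group) x y = (antipodal_class x == antipodal_class y).
Proof.
apply/idP/idP=> [/connectP[s] | /antipodal_classP].
  elim: s x => [|z s IHs] x /= => [_ -> // | /andP[xz zs] /(IHs _ zs)].
  move/eqP=> <-; apply/antipodal_classP; right; apply/eqP.
  by rewrite -saxl_twist_group.
case=> def_y; last by rewrite connect1 // saxl_twist_group def_y.
(* Points with the same first coordinate are joined through a common neighbour over the antipode. *)
apply: (@connect_trans _ _ (x.1 + half, x.2)); apply: connect1.
  by rewrite saxl_twist_group.
by rewrite saxl_twist_group def_y add_halfK.
Qed.

Lemma n_comp_saxl : n_comp (saxl_graph twist_group) omega = p.
Proof.
rewrite (n_comp_fibers (@saxl_connect_sym _ _) connect_saxl) ?card_ord // => c.
exists (inZp c, [ffun=> false]); apply/val_inj => /=.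
by have lt_c := ltn_ord c; rewrite !modn_small //; lia.
Qed.

(** * A block system *)

Lemma imprimitive_twist_group : imprimitive twist_group.
Proof.
(* The blocks are the fibres of the first coordinate, and [twist r v] sends the one over [i] to the
   one over [i + r]. *)
pose block (i : circle) : {set omega} := [set x | x.1 == i].
have block_neq0 i : (i, [ffun=> false]) \in block i by rewrite inE.
have block_inj : injective block.
  by move=> i j eq_ij; have := block_neq0 i; rewrite eq_ij inE => /eqP.
have card_blocks : #|[set block i | i in setT]| = q.*2.+2.
  by rewrite card_imset // cardsT card_ord.
apply/existsP; exists [set block i | i in setT]; apply/and3P; split.
- apply/and3P; split.
  + rewrite eqEsubset subsetT; apply/subsetP=> x _; apply/bigcupP.
    by exists (block x.1); rewrite ?inE ?imset_f.
  + apply/trivIsetP=> _ _ /imsetP[i _ ->] /imsetP[j _ ->].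
    apply: contraR => /pred0Pn[x /andP[/= /[!inE] /eqP xi /eqP xj]].
    by rewrite -xi xj.
  + by apply/imsetP=> -[i _ i0]; have := block_neq0 i; rewrite -i0 inE.
- apply/subsetP=> g /twist_groupP[r [v def_g]]; rewrite !inE.
  apply/subsetP=> _ /imsetP[i _ ->]; rewrite inE; apply/imsetP.
  exists (i + r) => //; apply/setP=> y; rewrite inE.
  apply/imsetP/eqP=> [[x /[!inE] /eqP <- ->] | y_ir].
    by rewrite /= /aperm def_g.
  exists (g^-1%g y); last by rewrite /= /aperm permKV.
  by rewrite inE -(inj_eq (addIr r)) -y_ir -{2}(permKV g y) def_g.
(* There are 2p blocks for 2p * 2^p points, so the system is nontrivial. *)
- rewrite card_blocks cardsT card_prod card_ffun card_bool !card_ord.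
  by rewrite ltn_Pmulr // (ltn_exp2l 0).
Qed.

End HalfCircles.

Theorem proposition4p1 (p : nat) (p_prime : prime p) (p_odd : odd p) :
  exists (Omega : finType) (G : {group {perm Omega}}),
    [/\ [transitive G, on [set: Omega] | 'P],
        imprimitive G,
        base_size G = 2
      & n_comp (saxl_graph G) Omega = p].
Proof.
case: p p_prime p_odd => // q _ _; exists (omega q), (twist_group q); split.
- exact: twist_group_trans.
- exact: imprimitive_twist_group.
- exact: base_size_twist_group.
- exact: n_comp_saxl.
Qed.
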